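(* Let $b\ge0$. Then the oracle clipped sum $\mathrm{CS}_+^{\mathrm{or.}}$ is $(b,\rho)$-robust with $\rho=1$, and the oracle clipped sum $\mathrm{CS}_{\mathrm{He}}^{\mathrm{or.}}$ is $(b,\rho)$-robust with $\rho=4$.
   Context: Here the rules are oracle rules: they also take as input the set $S\subset[n]$. An oracle rule $F(\,\cdot\,;S)$ is $(b,\rho)$-robust if for all vectors $z_i\in\mathbb R^d$, all weights $\omega_i\ge0$ ($i\in[n]$) and all $S\subset[n]$ with $\sum_{i\in[n]\setminus S}\omega_i\le b$, $$\Bigl\|F\bigl((\omega_i,z_i)_{i\in[n]};S\bigr)-\sum_{i\in S}\omega_iz_i\Bigr\|^2\le\rho b\sum_{i\in S}\omega_i\|z_i\|^2.$$ For $z\in\mathbb R^d$ and $\tau\ge0$, $\mathrm{Clip}(z;\tau)=\frac{z}{\|z\|}\min(\|z\|,\tau)$, with $\mathrm{Clip}(0;\tau)=0$. Both rules have the form $\sum_{i=1}^n\omega_i\,\mathrm{Clip}(z_i;\tau)$ with the following thresholds. $\mathrm{CS}_+^{\mathrm{or.}}$: $\tau=\max\{\tau\ge0:\ \sum_{i\in S}\omega_i\mathbf 1_{\|z_i\|\ge\tau}\ge b\}$, with the conventions $\tau=0$ if the set is empty and $\tau=+\infty$ (no clipping) if it is unbounded, i.e. if $b=0$. $\mathrm{CS}_{\mathrm{He}}^{\mathrm{or.}}$: $\tau=\sqrt{\frac1b\sum_{i\in S}\omega_i\|z_i\|^2}$, with the convention $\tau=+\infty$ if $b=0$. *)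

(* Defs.v *)
From mathcomp Require Import all_boot all_order all_algebra.
From mathcomp Require Import all_classical all_reals.

Set Implicit Arguments.
Unset Strict Implicit.
Unset Printing Implicit Defensive.

Import Order.TTheory GRing.Theory Num.Theory.

Local Open Scope ring_scope.

(* Not the norm `|z| that MathComp-Analysis puts on 'rV[R]_d: that one is the
   sup norm. *)
Definition enorm (R : realType) (d : nat) (z : 'rV[R]_d) : R :=
  Num.sqrt (\sum_(k < d) z ord0 k ^+ 2).

(* A family wz : 'I_n -> R * 'rV[R]_d lists the pairs (weight, vector), so
   (wz i).1 is omega_i and (wz i).2 is z_i. *)
Definition oracle_rule (R : realType) (n d : nat) : Type :=
  ('I_n -> R * 'rV[R]_d) -> {set 'I_n} -> 'rV[R]_d.

Definition robust (R : realType) (n d : nat) (b rho : R)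
    (F : oracle_rule R n d) : Prop :=
  forall (z : 'I_n -> 'rV[R]_d) (w : 'I_n -> R) (S : {set 'I_n}),
    (forall i, 0 <= w i) ->
    \sum_(i in ~: S) w i <= b ->
    enorm (F (fun i => (w i, z i)) S - \sum_(i in S) w i *: z i) ^+ 2
      <= rho * b * \sum_(i in S) w i * enorm (z i) ^+ 2.

(* Thresholds are extended reals, +oo meaning no clipping. The minimum is at
   most enorm z, so it is finite for tau >= 0 and fine only changes its type. *)
Definition clip (R : realType) (d : nat) (z : 'rV[R]_d) (tau : \bar R) :
    'rV[R]_d :=
  if z == 0 then 0
  else fine (Order.min (enorm z)%:E tau) *: ((enorm z)^-1 *: z).

Definition clipped_sum (R : realType) (n d : nat)
    (threshold : ('I_n -> R * 'rV[R]_d) -> {set 'I_n} -> \bar R) :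
    oracle_rule R n d :=
  fun wz S => \sum_(i < n) (wz i).1 *: clip (wz i).2 (threshold wz S).

Definition plus_levels (R : realType) (n d : nat) (b : R)
    (wz : 'I_n -> R * 'rV[R]_d) (S : {set 'I_n}) : set R :=
  [set t : R | 0 <= t /\
     b <= \sum_(i in S) (wz i).1 * (t <= enorm (wz i).2)%R%:R]%classic.

(* xget 0 (A `&` ubound A) is the maximum of A. The default 0 is irrelevant:
   a nonempty bounded set of levels has a maximum, because its defining sum is
   a left-continuous nonincreasing step function of t when the weights are
   nonnegative. *)
Definition plus_threshold (R : realType) (n d : nat) (b : R)
    (wz : 'I_n -> R * 'rV[R]_d) (S : {set 'I_n}) : \bar R :=
  let A := plus_levels b wz S in
  if `[< A = set0 >] then 0%:E
  else if `[< has_ubound A >] then (xget 0 (A `&` ubound A)%classic)%:E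
  else +oo%E.

Definition CS_plus_oracle (R : realType) (n d : nat) (b : R) :
    oracle_rule R n d :=
  clipped_sum (plus_threshold b).

Definition He_threshold (R : realType) (n d : nat) (b : R)
    (wz : 'I_n -> R * 'rV[R]_d) (S : {set 'I_n}) : \bar R :=
  if b == 0 then +oo%E
  else (Num.sqrt (b^-1 * \sum_(i in S) (wz i).1 * enorm (wz i).2 ^+ 2))%:E.

Definition CS_He_oracle (R : realType) (n d : nat) (b : R) :
    oracle_rule R n d :=
  clipped_sum (He_threshold b).

(* Main.v *)
(* The error of a clipped sum is at most sum_(i in S) w_i (|z_i| - tau)_+ + b tau.
   For CS_+, the weights of {i in S : |z_i| > tau} sum to at most b and those of
   {i in S : |z_i| >= tau} to at least b; so the bound is at most a sum of norms
   of total weight exactly b, and Cauchy-Schwarz concludes.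
   For CS_He, with V = sum_(i in S) w_i |z_i|^2 = b tau^2, the inequality
   (r - tau)_+ tau <= r^2 bounds tau times the error by 2 V. *)
Require Import Defs.
From mathcomp Require Import all_boot all_order all_algebra.
From mathcomp Require Import all_classical all_reals.
From mathcomp Require Import ring lra.

Import Order.TTheory GRing.Theory Num.Theory.

Local Open Scope ring_scope.

(** A quadratic [b m^2 - 2 E m + V] that is never negative has discriminant at most 0. In this form
    Cauchy-Schwarz follows from an inequality in a free [m] that can be checked term by term. *)
Lemma sqr_le_mul_of_quadratic (R : realFieldType) (E V b : R) :
  0 <= b -> (forall m, 2 * m * E <= V + b * m ^+ 2) -> E ^+ 2 <= b * V.
Proof.
rewrite le_eqVlt => /orP[/eqP<- H|b0 H].
  have [->|E0] := eqVneq E 0; first by rewrite expr0n mul0r.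
  (* For [b = 0] and [E] nonzero, this [m] would give [V + 1 <= V]. *)
  have := H ((V + 1) / (2 * E)).
  have -> : 2 * ((V + 1) / (2 * E)) * E = V + 1 by field.
  lra.
(* The minimizer of the quadratic. *)
have := H (E / b).
have -> : 2 * (E / b) * E = 2 * (E ^+ 2 / b) by field; lra.
have -> : b * (E / b) ^+ 2 = E ^+ 2 / b by field; lra.
move=> h; have {h} : E ^+ 2 / b <= V by lra.
by rewrite ler_pdivrMr // mulrC.
Qed.

(** * Euclidean norm and clipping of a single vector *)

Section EuclideanNorm.
Context {R : realType} {d : nat}.
Implicit Types x y z : 'rV[R]_d.

Lemma enorm_ge0 z : 0 <= enorm z.
Proof. exact: sqrtr_ge0. Qed.

Lemma sqr_enorm z : enorm z ^+ 2 = \sum_(k < d) z ord0 k ^+ 2.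
Proof. by rewrite sqr_sqrtr // sumr_ge0 // => k _; rewrite sqr_ge0. Qed.

Lemma enorm0 : enorm (0 : 'rV[R]_d) = 0.
Proof.
by apply/eqP; rewrite -sqrf_eq0 sqr_enorm big1 // => k _; rewrite mxE expr0n.
Qed.

Lemma enorm_eq0 z : (enorm z == 0) = (z == 0).
Proof.
apply/eqP/eqP => [z0|->]; last exact: enorm0.
have /eqP := sqr_enorm z; rewrite z0 expr0n eq_sym psumr_eq0; last first.
  by move=> k _; rewrite sqr_ge0.
move=> /allP h; apply/rowP => k; rewrite mxE; apply/eqP.
by rewrite -sqrf_eq0 (implyP (h k (mem_index_enum k))).
Qed.

Lemma enormZ (a : R) z : enorm (a *: z) = `|a| * enorm z.
Proof.
rewrite /enorm -sqrtr_sqr -sqrtrM ?sqr_ge0 // mulr_sumr.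
by congr Num.sqrt; apply: eq_bigr => k _; rewrite mxE exprMn.
Qed.

Lemma enorm_cauchy_schwarz x y :
  \sum_(k < d) x ord0 k * y ord0 k <= enorm x * enorm y.
Proof.
apply: (le_trans (ler_norm _)).
rewrite -ler_sqr ?nnegrE ?mulr_ge0 ?enorm_ge0 // real_normK ?num_real //.
rewrite exprMn; apply: sqr_le_mul_of_quadratic => [|m]; first exact: sqr_ge0.
rewrite !sqr_enorm mulr_sumr mulr_suml -big_split /=.
apply: ler_sum => k _.
by have := sqr_ge0 (m * x ord0 k - y ord0 k); nra.
Qed.

Lemma enormD x y : enorm (x + y) <= enorm x + enorm y.
Proof.
rewrite -ler_sqr ?nnegrE ?addr_ge0 ?enorm_ge0 //.
have -> : enorm (x + y) ^+ 2 =
    enorm x ^+ 2 + enorm y ^+ 2 + 2 * \sum_(k < d) x ord0 k * y ord0 k.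
  rewrite !sqr_enorm mulr_sumr -!big_split /=.
  by apply: eq_bigr => k _; rewrite mxE; ring.
by have := enorm_cauchy_schwarz x y; nra.
Qed.

Lemma enorm_sum (I : Type) (r : seq I) (P : pred I) (F : I -> 'rV[R]_d) :
  enorm (\sum_(i <- r | P i) F i) <= \sum_(i <- r | P i) enorm (F i).
Proof.
elim/big_ind2: _ => [|x a y c xa yc|//]; first by rewrite enorm0.
by rewrite (le_trans (enormD _ _)) // lerD.
Qed.

Lemma clip_pinfty z : clip z +oo%E = z.
Proof.
rewrite /clip; case: eqVneq => [->//|z0].
by rewrite min_l ?leey //= scalerA divff ?scale1r // enorm_eq0.
Qed.

Lemma clip_finE z (t : R) :
  clip z t%:E = (Num.min (enorm z) t / enorm z) *: z.
Proof.
rewrite /clip; case: eqVneq => [->|_]; first by rewrite scaler0.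
by rewrite scalerA -EFin_min.
Qed.

Lemma enorm_clip_le z (t : R) : 0 <= t -> enorm (clip z t%:E) <= t.
Proof.
move=> t0; rewrite clip_finE enormZ.
have [r0|r0] := eqVneq (enorm z) 0; first by rewrite r0 mulr0.
rewrite ger0_norm ?divr_ge0 ?le_min ?enorm_ge0 ?t0 //.
by rewrite divfK // ge_min lexx orbT.
Qed.

Lemma enorm_clip_sub z (t : R) :
  0 <= t -> enorm (clip z t%:E - z) = Num.max (enorm z - t) 0.
Proof.
move=> t0; rewrite clip_finE -[X in _ - X]scale1r -scalerBl enormZ.
have [r0|r0] := eqVneq (enorm z) 0.
  by rewrite r0 mulr0; case: ltP => //; lra.
have rp : 0 < enorm z by rewrite lt0r r0 enorm_ge0.
rewrite -{3}(ger0_norm (enorm_ge0 z)) -normrM mulrBl divfK // mul1r.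
case: (leP (enorm z) t) => h.
  by rewrite subrr normr0 max_r // subr_le0.
by rewrite distrC gtr0_norm ?subr_gt0 // max_l // subr_ge0 ltW.
Qed.

End EuclideanNorm.

(** * Error of a clipped sum *)

Section ClippedSum.
Context {R : realType} {n d : nat}.
Variables (b : R) (z : 'I_n -> 'rV[R]_d) (w : 'I_n -> R) (S : {set 'I_n}).
Hypotheses (w_ge0 : forall i, 0 <= w i) (w_out : \sum_(i in ~: S) w i <= b).

Local Notation V := (\sum_(i in S) w i * enorm (z i) ^+ 2).
Local Notation error t :=
  (enorm (\sum_(i < n) w i *: clip (z i) t - \sum_(i in S) w i *: z i)).
Local Notation levels := (plus_levels b (fun i => (w i, z i)) S).

Lemma clip_error_split (t : \bar R) :
  \sum_(i < n) w i *: clip (z i) t - \sum_(i in S) w i *: z i =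
  \sum_(i in S) w i *: (clip (z i) t - z i) +
  \sum_(i in ~: S) w i *: clip (z i) t.
Proof.
rewrite (bigID (mem S)) /= addrAC -sumrB; congr (_ + _).
  by apply: eq_bigr => i _; rewrite scalerBr.
by apply: eq_bigl => i; rewrite inE.
Qed.

(** Inside [S], clipping moves [z i] by the excess of its norm over [t]; outside [S], each clipped
    vector has norm at most [t] and the total weight is at most [b]. *)
Lemma clip_error_le (t : R) : 0 <= t ->
  error t%:E <= \sum_(i in S) w i * Num.max (enorm (z i) - t) 0 + b * t.
Proof.
move=> t0; rewrite clip_error_split (le_trans (enormD _ _)) // lerD //.
  apply: (le_trans (enorm_sum _ _ _ _)); apply: ler_sum => i _.
  by rewrite enormZ ger0_norm // enorm_clip_sub.
apply: (le_trans (enorm_sum _ _ _ _)).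
apply: le_trans (ler_wpM2r t0 w_out); rewrite mulr_suml.
apply: ler_sum => i _.
by rewrite enormZ ger0_norm // ler_wpM2l // enorm_clip_le.
Qed.

Lemma unclipped_error : b = 0 -> error +oo%E = 0.
Proof.
move=> b0; rewrite clip_error_split !big1 ?addr0 ?enorm0 // => i iS.
  rewrite (_ : w i = 0) ?scale0r //; apply/eqP; rewrite eq_le w_ge0 andbT.
  rewrite -b0 (le_trans _ w_out) // (bigD1 i) //= lerDl.
  by rewrite sumr_ge0.
by rewrite clip_pinfty subrr scaler0.
Qed.

Lemma energy_ge0 : 0 <= V.
Proof. by apply: sumr_ge0 => i _; rewrite mulr_ge0 ?sqr_ge0. Qed.

(** * Levels and their maximum *)

Lemma le0_plus_level (t : R) : b <= 0 -> 0 <= t -> levels t.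
Proof.
move=> b0 t0; split=> //; apply: (le_trans b0).
by apply: sumr_ge0 => i _ /=; rewrite mulr_ge0 ?ler0n.
Qed.

(* The level found is the least norm among the indices satisfying p. *)
Lemma plus_level_at_norm (p : pred 'I_n) :
  0 < b -> b <= \sum_(i in S) w i * (p i)%:R ->
  exists2 i, p i & levels (enorm (z i)).
Proof.
move=> b0 bp; have [i0 /andP[i0S pi0]|none] := pickP [pred i in S | p i].
  have Pi0 : [pred i in S | p i] i0 by rewrite /= i0S.
  case: (arg_minP (fun i => enorm (z i)) Pi0) => i /= /andP[iS pi] imin.
  exists i => //; split; first exact: enorm_ge0.
  apply: (le_trans bp); apply: ler_sum => j jS /=; rewrite ler_wpM2l // ler_nat.
  case: (boolP (p j)) => // pj.
  by rewrite (imin j) // jS.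
move: bp; rewrite big1 ?leNgt ?b0 // => i iS.
by have := none i; rewrite /= iS /= => ->; rewrite mulr0.
Qed.

(** Every level lies below some norm that is itself a level, so the largest of the finitely many
    norms that are levels is the maximum. *)
Lemma plus_levels_max : 0 < b -> (levels !=set0)%classic ->
  exists t, (levels `&` ubound levels)%classic t.
Proof.
move=> b0 [t1 [_ bt1]].
have [i0 _ li0] := plus_level_at_norm _ b0 bt1.
have P0 : [pred i | `[< levels (enorm (z i)) >]] i0 by apply/asboolP.
case: (arg_maxP (fun i => enorm (z i)) P0) => i /= /asboolP li imax.
exists (enorm (z i)); split=> // t [_ bt].
have [j tj lj] := plus_level_at_norm _ b0 bt.
by apply: (le_trans tj); apply: imax; apply/asboolP.
Qed.

(** A larger weight would make some norm above [t] a level. *)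
Lemma weight_above_max_level (t : R) : 0 < b -> ubound levels t ->
  \sum_(i in S) w i * (t < enorm (z i))%R%:R <= b.
Proof.
move=> b0 ub; rewrite leNgt; apply/negP => /ltW h.
have [i ti li] := plus_level_at_norm _ b0 h.
by have := ub _ li; rewrite leNgt ti.
Qed.

(** * Error bound for the threshold of [CS_plus_oracle] *)

Lemma plus_error_le (t : R) : 0 <= b -> 0 <= t ->
  b <= \sum_(i in S) w i * (t <= enorm (z i))%R%:R ->
  \sum_(i in S) w i * (t < enorm (z i))%R%:R <= b ->
  error t%:E ^+ 2 <= b * V.
Proof.
move=> b0 t0; set W2 := (X in b <= X) => bW2; set W := (X in X <= b) => Wb.
set E := \sum_(i in S) w i * Num.max (enorm (z i) - t) 0 + b * t.
apply: (@le_trans _ _ (E ^+ 2)).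
  have leE := clip_error_le _ t0.
  by rewrite ler_sqr ?nnegrE ?enorm_ge0 ?(le_trans (enorm_ge0 _) leE).
apply: sqr_le_mul_of_quadratic => // m.
(* With [r] the norm of [z i]: if [r > t] this is [(r - m)^2 >= 0]; if [r = t], the term [r^2] of
   [V] pays for [t^2], [W2 - W] being the weight at norm exactly [t]. *)
have termwise : 2 * m * \sum_(i in S) w i * Num.max (enorm (z i) - t) 0 <=
    V - t ^+ 2 * (W2 - W) + (m ^+ 2 - 2 * m * t) * W.
  rewrite /W2 /W -sumrB !mulr_sumr -sumrB -big_split /=.
  apply: ler_sum => i _.
  rewrite [leLHS](_ : _ = w i * (2 * m * Num.max (enorm (z i) - t) 0)); last by ring.
  rewrite [leRHS](_ : _ = w i * (enorm (z i) ^+ 2 -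
      t ^+ 2 * ((t <= enorm (z i))%R%:R - (t < enorm (z i))%R%:R) +
      (m ^+ 2 - 2 * m * t) * (t < enorm (z i))%R%:R)); last by ring.
  apply: ler_wpM2l => //.
  case: (ltgtP t (enorm (z i))) => [tr|rt|<-] /=.
  - rewrite max_l ?subr_ge0 ?(ltW tr) //.
    by have := sqr_ge0 (enorm (z i) - m); nra.
  - rewrite max_r ?subr_le0 ?(ltW rt) //.
    by have := sqr_ge0 (enorm (z i)); nra.
  - by rewrite subrr maxxx; nra.
(* The gap between [V + b m^2] and the bound on [2 m E] given by [termwise] is exactly the sum of
   these two products. *)
have h1 : 0 <= t ^+ 2 * (W2 - b) by rewrite mulr_ge0 ?sqr_ge0 ?subr_ge0.
have h2 : 0 <= (m - t) ^+ 2 * (b - W) by rewrite mulr_ge0 ?sqr_ge0 ?subr_ge0.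
by rewrite /E; nra.
Qed.

(** Serves the case without levels, where [S] has weight below [b]; the error is then at most a
    weighted sum of norms, and weighted Cauchy-Schwarz applies. *)
Lemma zero_threshold_error :
  \sum_(i in S) w i <= b -> error 0%:E ^+ 2 <= b * V.
Proof.
move=> wb; have b0 : 0 <= b by apply: le_trans wb; apply: sumr_ge0.
set E := \sum_(i in S) w i * enorm (z i).
apply: (@le_trans _ _ (E ^+ 2)).
  have leE : error 0%:E <= E.
    apply: (le_trans (clip_error_le _ (lexx 0))); rewrite mulr0 addr0.
    by apply: ler_sum => i _; rewrite subr0 max_l ?enorm_ge0.
  by rewrite ler_sqr ?nnegrE ?enorm_ge0 ?(le_trans (enorm_ge0 _) leE).
apply: sqr_le_mul_of_quadratic => // m.
apply: (@le_trans _ _ (V + (\sum_(i in S) w i) * m ^+ 2)).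
  rewrite mulr_sumr mulr_suml -big_split /=; apply: ler_sum => i _.
  by have := mulr_ge0 (w_ge0 i) (sqr_ge0 (enorm (z i) - m)); nra.
by rewrite lerD2l ler_wpM2r ?sqr_ge0.
Qed.

Lemma plus_threshold_error : 0 <= b ->
  error (plus_threshold b (fun i => (w i, z i)) S) ^+ 2 <= b * V.
Proof.
move=> b0; rewrite /plus_threshold; case: asboolP => [empty|/eqP/set0P nonempty].
  apply: zero_threshold_error; rewrite leNgt; apply/negP => bw.
  have : levels 0.
    split=> //; apply: (le_trans (ltW bw)).
    by apply: ler_sum => i _; rewrite enorm_ge0 mulr1.
  by rewrite empty.
case: asboolP => [[u ub]|unbounded].
  have {}b0 : 0 < b.
    rewrite ltNge; apply/negP => ble0.
    (* If [b <= 0], every nonnegative number is a level, even one beyond the bound [u]. *)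
    have := ub (`|u| + 1) (le0_plus_level _ ble0 (addr_ge0 (normr_ge0 u) ler01)).
    by have := ler_norm u; lra.
  (* The default of [xget] is never reached, since the maximum exists. *)
  case: xgetP => [t _ [[t0 bt] tub]|none]; last first.
    by have [t /none] := plus_levels_max b0 nonempty.
  apply: plus_error_le => //; first exact: ltW.
  exact: weight_above_max_level.
(* For [b > 0] the maximum would bound the levels. *)
have b_eq0 : b = 0.
  apply/eqP; move: b0; rewrite le_eqVlt eq_sym => /orP[//|b0].
  have [t [_ tub]] := plus_levels_max b0 nonempty.
  by case: unbounded; exists t.
by rewrite unclipped_error // expr0n b_eq0 mul0r.
Qed.

(** * Error bound for the threshold of [CS_He_oracle] *)

Lemma He_error_le (t : R) : 0 <= b -> 0 <= t -> b * t ^+ 2 = V ->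
  error t%:E ^+ 2 <= 4 * b * V.
Proof.
move=> b0 t0 tV; have leE := clip_error_le _ t0; set e := error _ in leE *.
have e0 : 0 <= e := enorm_ge0 _.
(* The main argument cancels a factor [V]. When [V = 0], both parts of the bound [leE] vanish, hence
   so does [e]. *)
have [V0|Vn0] := eqVneq V 0.
  rewrite V0 mulr0.
  have bt0 : b * t = 0.
    move/eqP: tV; rewrite V0 mulf_eq0 sqrf_eq0 => /orP[]/eqP->.
      by rewrite mul0r.
    by rewrite mulr0.
  have wr0 i : i \in S -> w i * Num.max (enorm (z i) - t) 0 = 0.
    move=> iS; move/eqP: V0; rewrite psumr_eq0; last first.
      by move=> j _; rewrite mulr_ge0 ?sqr_ge0.
    move=> /allP/(_ i (mem_index_enum i)); rewrite iS /=.
    rewrite mulf_eq0 sqrf_eq0 => /orP[]/eqP->; first by rewrite mul0r.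
    by rewrite max_r ?mulr0 // subr_le0.
  move: leE; rewrite bt0 addr0 big1 // => ele0.
  by rewrite (_ : e = 0) ?expr0n //; apply: le_anti; rewrite ele0 e0.
have V0 : 0 < V by rewrite lt0r Vn0 energy_ge0.
have te : e * t <= 2 * V.
  apply: (le_trans (ler_wpM2r t0 leE)).
  rewrite mulrDl -mulrA -expr2 tV mulr_natl mulr2n lerD2r mulr_suml.
  apply: ler_sum => i _; rewrite -mulrA ler_wpM2l //.
  case: (leP (enorm (z i) - t) 0) => h; first by rewrite mul0r sqr_ge0.
  by have := enorm_ge0 (z i); nra.
have te2 : (e * t) ^+ 2 <= (2 * V) ^+ 2.
  by rewrite ler_sqr ?nnegrE ?mulr_ge0 ?energy_ge0.
(* Multiplying the goal by [V = b t^2] turns it into [b (e t)^2 <= b (2 V)^2]. *)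
rewrite -(ler_pM2r V0) -{1}tV.
rewrite [leLHS](_ : _ = b * (e * t) ^+ 2); last by ring.
rewrite [leRHS](_ : _ = b * (2 * V) ^+ 2); last by ring.
exact: ler_wpM2l.
Qed.

Lemma He_threshold_error : 0 <= b ->
  error (He_threshold b (fun i => (w i, z i)) S) ^+ 2 <= 4 * b * V.
Proof.
move=> b0; rewrite /He_threshold; case: eqVneq => [b_eq0|bn0].
  by rewrite unclipped_error // expr0n b_eq0 mulr0 mul0r.
apply: He_error_le; rewrite ?sqrtr_ge0 // sqr_sqrtr; last first.
  by rewrite mulr_ge0 ?invr_ge0 ?energy_ge0.
by rewrite mulrA divff // mul1r.
Qed.

End ClippedSum.

Theorem theorem4p3 (R : realType) (n d : nat) (b : R) (hb : 0 <= b) :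
  robust b 1 (@CS_plus_oracle R n d b) /\ robust b 4 (@CS_He_oracle R n d b).
Proof.
split=> z w S w_ge0 w_out; last exact: He_threshold_error.
by rewrite mul1r; exact: plus_threshold_error.
Qed.
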